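(* Let $f:[t_0,T]\times\mathbb{R}\to\mathbb{R}$ be Lipschitz continuous in its second argument and sufficiently many times differentiable, let $y_0\in\mathbb{R}$, $\sigma^2>0$, $N\in\mathbb{N}$, and let $h>0$ with $t_0+Nh\le T$; put $t_n=t_0+nh$ for $0\le n\le N$. Let $m_{t_n}\in\mathbb{R}^2$, $0\le n\le N$, be the predictive posterior means produced by the probabilistic filtering ODE solver (PFOS) arising from the once integrated Wiener process IWP$(1)$ with intensity $\sigma^2$, applied to $y'=f(t,y)$, $y(t_0)=y_0$ on this mesh. Then the PFOS is equivalent in its predictive posterior mean to the P(EC)$^1$ implementation of the trapezoidal rule: if $(y_n)_{0\le n\le N}$ denotes the sequence of numerical approximations generated by the P(EC)$^1$ implementation of the trapezoidal rule with step size $h$ and initial value $y_0$, then $$(m_{t_n})_0 = y_n\qquad\text{for all } 0\le n\le N .$$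
   Context: Vectors and matrices are indexed from $0$; $e_0,e_1$ denote the standard basis vectors of $\mathbb{R}^2$, and $H_0=e_0^{\top}$, $H_1=e_1^{\top}$ (row vectors). IWP$(1)$: the process $X_t=(Y_t,Y_t')^{\top}$ given by $dX_t=\begin{pmatrix}0&1\\0&0\end{pmatrix}X_t\,dt+e_1\,dW_t$, where $W$ is a Wiener process of intensity $\sigma^2$. Its discrete transition and diffusion matrices for step length $s\ge 0$ are $$A(s)=\begin{pmatrix}1&s\\0&1\end{pmatrix},\qquad Q(s)=\sigma^2\begin{pmatrix}s^3/3&s^2/2\\ s^2/2&s\end{pmatrix}.$$ PFOS for IWP$(1)$ (Kalman filter with noise-free derivative observations): set $t_{-1}=t_0$ and start from a prior mean $m^-_{t_{-1}}\in\mathbb{R}^2$ and a positive definite prior covariance matrix $C^-_{t_{-1}}\in\mathbb{R}^{2\times2}$. First condition on the initial value: $$K_{-1}=C^-_{t_{-1}}H_0^{\top}[H_0C^-_{t_{-1}}H_0^{\top}]^{-1},\quad m_{t_{-1}}=m^-_{t_{-1}}+K_{-1}(y_0-H_0m^-_{t_{-1}}),\quad C_{t_{-1}}=C^-_{t_{-1}}-K_{-1}[H_0C^-_{t_{-1}}H_0^{\top}]K_{-1}^{\top}.$$ Then for $n=0,1,\dots,N$, with $h_n=t_n-t_{n-1}$ (so $h_0=0$ and $h_n=h$ for $n\ge1$), compute $$m^-_{t_n}=A(h_n)m_{t_{n-1}},\quad C^-_{t_n}=A(h_n)C_{t_{n-1}}A(h_n)^{\top}+Q(h_n),\quad z_n=f(t_n,H_0m^-_{t_n}),$$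 $$K_n=C^-_{t_n}H_1^{\top}[H_1C^-_{t_n}H_1^{\top}]^{-1},\quad m_{t_n}=m^-_{t_n}+K_n(z_n-H_1m^-_{t_n}),\quad C_{t_n}=C^-_{t_n}-K_n[H_1C^-_{t_n}H_1^{\top}]K_n^{\top}.$$ The vectors $m_{t_n}$ are the predictive posterior means. Trapezoidal rule: the implicit multistep method $y_n=y_{n-1}+\frac h2(f_{n-1}+f_n)$, where $f_n$ approximates $y'(t_n)$. Its P(EC)$^1$ (predict, evaluate once, correct once, without a final re-evaluation) implementation is: $f_0=f(t_0,y_0)$, and for $n\ge1$ $$f_n=f(t_n,\;y_{n-1}+h f_{n-1}),\qquad y_n=y_{n-1}+\tfrac h2(f_{n-1}+f_n).$$ *)

(* Defs.v *)
(* Mathematical Components and MathComp-Analysis. *)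
From HB Require Import structures.
From mathcomp Require Import all_boot all_order all_algebra.
From mathcomp Require Import all_classical all_reals all_analysis.

Set Implicit Arguments.
Unset Strict Implicit.
Unset Printing Implicit Defensive.

Import Order.TTheory GRing.Theory Num.Theory.
Import numFieldNormedType.Exports.

Local Open Scope classical_set_scope.
Local Open Scope ring_scope.

(* A right-hand side f : [t0, T] x R -> R is represented by a total function
   R -> R -> R, about which hypotheses are made only on the strip. *)
Definition strip (R : realType) (t0 T : R) : set (R * R) :=
  `[t0, T] `*` setT.

(* The Lipschitz constant is uniform in t. *)
Definition lipschitz_in_2nd (R : realType) (t0 T : R) (f : R -> R -> R) : Prop :=
  exists L : R, forall t, t \in `[t0, T] -> L.-lipschitz (f t).

(* g has total differential (u, v) |-> a p * u + b p * v at every p in D; the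
   filter [within D] makes this one-sided at boundary points of D. *)
Definition has_partials_on (R : realType) (D : set (R * R))
    (g a b : R * R -> R) : Prop :=
  forall p, D p -> let F := within D (nbhs p) in
    (fun q => g q - g p - (a p * (q.1 - p.1) + b p * (q.2 - p.2)) : R)
      =o_F (fun q => q - p).

Fixpoint differentiable_times (R : realType) (r : nat) (D : set (R * R))
    (g : R * R -> R) : Prop :=
  if r is r'.+1 then
    exists a b : R * R -> R, [/\ has_partials_on D g a b,
      differentiable_times r' D a & differentiable_times r' D b]
  else True.

Definition posdefmx (R : realType) (n : nat) (C : 'M[R]_n) : Prop :=
  C^T = C /\ forall x : 'cV[R]_n, x != 0 -> 0 < (x^T *m C *m x) 0 0.

Definition mx2 (R : realType) (a b c d : R) : 'M[R]_2 :=
  \matrix_(i, j) if i == 0 then (if j == 0 then a else b)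
                 else (if j == 0 then c else d).

(* Transition and diffusion matrices over a step s of the once integrated
   Wiener process dX = F X dt + e_1 dW with F = mx2 0 1 0 0 and W of intensity
   sigma^2, i.e. exp(s F) and
   sigma^2 \int_0^s exp(u F) e_1 e_1^T exp(u F)^T du. *)
Definition iwp1_A (R : realType) (s : R) : 'M[R]_2 := mx2 1 s 0 1.

Definition iwp1_Q (R : realType) (sigma s : R) : 'M[R]_2 :=
  sigma ^+ 2 *: mx2 (s ^+ 3 / 3) (s ^+ 2 / 2) (s ^+ 2 / 2) s.

Definition obs (R : realType) (i : 'I_2) : 'rV[R]_2 := delta_mx 0 i.

(* A Gaussian belief: mean and covariance. *)
Definition belief (R : realType) : Type := ('cV[R]_2 * 'M[R]_2)%type.

Definition kalman_predict (R : realType) (A Q : 'M[R]_2) (b : belief R)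
    : belief R :=
  (A *m b.1, A *m b.2 *m A^T + Q).

(* Noise-free observation of the value z of H X. *)
Definition kalman_update (R : realType) (H : 'rV[R]_2) (z : R) (b : belief R)
    : belief R :=
  let S : 'M[R]_1 := H *m b.2 *m H^T in
  let K : 'cV[R]_2 := b.2 *m H^T *m invmx S in
  (b.1 + K *m (z%:M - H *m b.1), b.2 - K *m S *m K^T).

Definition mesh (R : realType) (t0 h : R) (n : nat) : R := t0 + n%:R * h.

Definition pfos_step (R : realType) (f : R -> R -> R) (sigma t s : R)
    (b : belief R) : belief R :=
  let bm := kalman_predict (iwp1_A s) (iwp1_Q sigma s) b in
  kalman_update (obs R 1) (f t ((obs R 0 *m bm.1) 0 0)) bm.

(* [pfos_pre ... n] is (m_{t_{n-1}}, C_{t_{n-1}}).  Since 0.-1 = 0, the step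
   t_n - t_{n.-1} is 0 at n = 0, which is the convention t_{-1} = t_0. *)
Fixpoint pfos_pre (R : realType) (f : R -> R -> R) (sigma y0 : R) (t : nat -> R)
    (prior : belief R) (n : nat) : belief R :=
  if n is n'.+1 then
    pfos_step f sigma (t n') (t n' - t n'.-1)
      (pfos_pre f sigma y0 t prior n')
  else kalman_update (obs R 0) y0 prior.

Definition pfos_mean (R : realType) (f : R -> R -> R) (sigma y0 : R)
    (t : nat -> R) (prior : belief R) (n : nat) : 'cV[R]_2 :=
  (pfos_pre f sigma y0 t prior n.+1).1.

(* P(EC)^1 trapezoidal rule, as the sequence of pairs (y_n, f_n). *)
Fixpoint pec1_trapezoidal (R : realType) (f : R -> R -> R) (t0 y0 h : R)
    (n : nat) : R * R :=
  if n is n'.+1 then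
    let: (y, fy) := pec1_trapezoidal f t0 y0 h n' in
    let fn := f (mesh t0 h n) (y + h * fy) in
    (y + h / 2 * (fy + fn), fn)
  else (y0, f t0 y0).

(* Main.v *)
Require Import Defs.
From mathcomp Require Import all_boot all_order all_algebra.
From mathcomp Require Import all_classical all_reals all_analysis.
From mathcomp Require Import ring.

Set Implicit Arguments.
Unset Strict Implicit.
Unset Printing Implicit Defensive.

Import Order.TTheory GRing.Theory Num.Theory.
Import numFieldNormedType.Exports.

Local Open Scope ring_scope.

(** The two recursions agree because the gain of the filter is the same at
    every step of positive length.

    The invariant is that after the update at time t_n the mean is (y_n, f_n)
    and the covariance is diag(a, 0) for some a.  The second diagonal entry is 0
    because the derivative has just been observed without noise.  A transition
    leaves diag(a, 0) unchanged, A(h) diag(a, 0) A(h)^T = diag(a, 0), so the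
    column of the predicted covariance seen by the observation of the derivative
    is that of Q(h), namely sigma^2 (h^2/2, h): the unknown a does not enter, and
    the gain is (h/2, 1).  The mean moves from the prediction
    (y + h f_{n-1}, f_{n-1}) to (y + h f_{n-1} + h/2 (f_n - f_{n-1}), f_n), with
    f_n evaluated at the Euler predictor y + h f_{n-1}; this is the corrected
    trapezoidal value ([pfos_step_pec1]).

    The invariant holds at n = 0 because conditioning the prior on the initial
    value makes the mean (y0, _) and the covariance diag(0, c), where c is the
    Schur complement of C0, positive by definiteness ([posdefmx2_schur_gt0]).
    The step of length 0 that follows then has gain (0, 1): it keeps y0 and
    replaces the derivative by f(t0, y0). *)

Lemma obs_mulmx (R : realType) (p : nat) (i : 'I_2) (B : 'M[R]_(2, p)) k :
  (obs R i *m B) 0 k = B i k.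
Proof. by rewrite -rowE mxE. Qed.

Lemma mulmx_obsT (R : realType) (p : nat) (i : 'I_2) (B : 'M[R]_(p, 2)) j :
  (B *m (obs R i)^T) j 0 = B j i.
Proof. by rewrite trmx_delta -colE mxE. Qed.

Lemma kalman_gainE (R : realType) (i : 'I_2) (C : 'M[R]_2) j :
  (C *m (obs R i)^T *m invmx (obs R i *m C *m (obs R i)^T)) j 0 =
  C j i / C i i.
Proof.
rewrite [obs R i *m C *m _]mx11_scalar invmx_scalar mul_mx_scalar.
by rewrite mxE !mulmx_obsT obs_mulmx mulrC.
Qed.

Lemma kalman_update_mean (R : realType) (i : 'I_2) (z : R) (b : belief R) j :
  (kalman_update (obs R i) z b).1 j 0 =
  b.1 j 0 + b.2 j i / b.2 i i * (z - b.1 i 0).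
Proof.
have innovE : (z%:M - obs R i *m b.1) 0 0 = z - b.1 i 0.
  by rewrite mxE [X in X + _]mxE [X in _ + X]mxE obs_mulmx.
by rewrite mxE [X in _ + X]mxE big_ord1 kalman_gainE innovE.
Qed.

Lemma kalman_update_cov (R : realType) (i : 'I_2) (z : R) (b : belief R) j k :
  (kalman_update (obs R i) z b).2 j k =
  b.2 j k - b.2 j i * b.2 k i / b.2 i i.
Proof.
rewrite /kalman_update /= mxE [X in _ + X]mxE mxE big_ord1 mxE big_ord1.
rewrite [X in _ * X]mxE !kalman_gainE mulmx_obsT obs_mulmx.
(* x^-1 * x * x^-1 = x^-1 also at x = 0, since the inverse of 0 is 0. *)
congr (_ - _); have [->|C_neq0] := eqVneq (b.2 i i) 0.
  by rewrite invr0 !(mulr0, mul0r).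
by field.
Qed.

Lemma sum_ord2 (V : nmodType) (F : 'I_2 -> V) : \sum_i F i = F 0 + F 1.
Proof.
by rewrite big_ord_recl big_ord1; congr (_ + F _); apply: val_inj.
Qed.

Lemma iwp1_predict_mean0 (R : realType) (Q : 'M[R]_2) (s : R) (b : belief R) :
  (kalman_predict (iwp1_A s) Q b).1 0 0 = b.1 0 0 + s * b.1 1 0.
Proof. by rewrite mxE sum_ord2 !mxE /= mul1r. Qed.

Lemma iwp1_predict_mean1 (R : realType) (Q : 'M[R]_2) (s : R) (b : belief R) :
  (kalman_predict (iwp1_A s) Q b).1 1 0 = b.1 1 0.
Proof. by rewrite mxE sum_ord2 !mxE /= mul0r mul1r add0r. Qed.

Lemma iwp1_predict_cov01 (R : realType) (sigma s : R) (b : belief R) :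
  (kalman_predict (iwp1_A s) (iwp1_Q sigma s) b).2 0 1 =
  b.2 0 1 + s * b.2 1 1 + sigma ^+ 2 * (s ^+ 2 / 2).
Proof. by rewrite !(mxE, sum_ord2) /=; ring. Qed.

Lemma iwp1_predict_cov11 (R : realType) (sigma s : R) (b : belief R) :
  (kalman_predict (iwp1_A s) (iwp1_Q sigma s) b).2 1 1 =
  b.2 1 1 + sigma ^+ 2 * s.
Proof. by rewrite !(mxE, sum_ord2) /=; ring. Qed.

(** The diagonal entry [C i i] is the quadratic form of [C] at e_i. *)
Lemma posdefmx_diag_gt0 (R : realType) (C : 'M[R]_2) (i : 'I_2) :
  posdefmx C -> 0 < C i i.
Proof.
case=> _ /(_ (obs R i)^T); rewrite trmxK mulmx_obsT obs_mulmx; apply.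
by apply/eqP => /matrixP /(_ i 0) /eqP; rewrite !mxE !eqxx oner_eq0.
Qed.

(** The Schur complement is the quadratic form at (- C 1 0 / C 0 0, 1), its
    minimum over the vectors with last entry 1. *)
Lemma posdefmx2_schur_gt0 (R : realType) (C : 'M[R]_2) :
  posdefmx C -> 0 < C 1 1 - C 1 0 * C 1 0 / C 0 0.
Proof.
move=> posC; have C00_neq0 := lt0r_neq0 (posdefmx_diag_gt0 0 posC).
pose x : 'cV[R]_2 := \col_i if i == 0 then - C 1 0 / C 0 0 else 1.
have x_neq0 : x != 0.
  by apply/eqP => /matrixP /(_ 1 0) /eqP; rewrite !mxE /= oner_eq0.
have [symC /(_ x x_neq0)] := posC.
have C01 : C 0 1 = C 1 0 by rewrite -[in LHS]symC mxE.
rewrite !(mxE, sum_ord2) /= C01; congr (_ < _); field.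
exact: C00_neq0.
Qed.

Lemma kalman_update_obs_self (R : realType) (i : 'I_2) (z : R) (b : belief R) :
  b.2 i i != 0 -> (kalman_update (obs R i) z b).1 i 0 = z.
Proof. by move=> Cii; rewrite kalman_update_mean divff // mul1r addrC subrK. Qed.

(** The invariant, restricted to what determines all later means: for a
    symmetric covariance the last two conditions say that it is diag(a, 0), and
    a is left free because it enters no later gain. *)
Definition tracks (R : realType) (b : belief R) (yf : R * R) : Prop :=
  [/\ b.1 0 0 = yf.1, b.1 1 0 = yf.2, b.2 0 1 = 0 & b.2 1 1 = 0].

(** Once observed without noise, the derivative is known exactly: its gain on
    itself is 1, and its covariances with both coordinates drop to 0 whatever
    they were before. *)
Lemma tracks_update (R : realType) (y z : R) (b : belief R) :
    b.2 1 1 != 0 ->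
    b.1 0 0 + b.2 0 1 / b.2 1 1 * (z - b.1 1 0) = y ->
  tracks (kalman_update (obs R 1) z b) (y, z).
Proof.
move=> C11 <-; split; rewrite /= ?kalman_update_mean ?kalman_update_cov //.
all: by field.
Qed.

(** A step of length 0 neither moves nor diffuses, so the gain is computed from
    the prior conditioned on the initial value.  That covariance is diag(0, c)
    with c > 0, so the gain is (0, 1): y0 is kept, the derivative replaced. *)
Lemma pfos_step_init (R : realType) (f : R -> R -> R) (sigma t y0 : R)
    (m0 : 'cV[R]_2) (C0 : 'M[R]_2) :
    posdefmx C0 ->
  tracks (pfos_step f sigma t 0 (kalman_update (obs R 0) y0 (m0, C0)))
    (y0, f t y0).
Proof.
move=> posC.
have C00_neq0 := lt0r_neq0 (posdefmx_diag_gt0 0 posC).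
have schur_neq0 := lt0r_neq0 (posdefmx2_schur_gt0 posC).
have m00 : (kalman_update (obs R 0) y0 (m0, C0)).1 0 0 = y0.
  exact: kalman_update_obs_self.
rewrite /pfos_step obs_mulmx iwp1_predict_mean0 mul0r addr0 m00.
apply: tracks_update.
  by rewrite iwp1_predict_cov11 mulr0 addr0 kalman_update_cov.
rewrite iwp1_predict_mean0 iwp1_predict_cov01 kalman_update_cov /= m00.
(* By symmetry C01 - C00 * C10 / C00 = 0: an exactly known value is
   uncorrelated with the derivative. *)
have -> : C0 0 1 = C0 1 0 by case: posC => {2}<-; rewrite mxE.
rewrite (mulrAC (C0 0 0)) divff // mul1r subrr.
by rewrite expr0n /= !(mul0r, mulr0, addr0).
Qed.

(** The predicted covariances with the derivative come from the diffusion
    alone, as the previous ones vanish.  They are sigma^2 s^2/2 and sigma^2 s,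
    whose quotient is the weight s/2 of the trapezoidal rule. *)
Lemma pfos_step_pec1 (R : realType) (f : R -> R -> R) (sigma t s y fy : R)
    (b : belief R) :
    sigma != 0 -> s != 0 -> tracks b (y, fy) ->
  let z := f t (y + s * fy) in
  tracks (pfos_step f sigma t s b) (y + s / 2 * (fy + z), z).
Proof.
move=> sigma_neq0 s_neq0 [/= b0 b1 C01 C11].
rewrite /pfos_step obs_mulmx iwp1_predict_mean0 b0 b1.
have predC11 : (kalman_predict (iwp1_A s) (iwp1_Q sigma s) b).2 1 1 =
    sigma ^+ 2 * s by rewrite iwp1_predict_cov11 C11 add0r.
apply: tracks_update; first by rewrite predC11 mulf_neq0 // expf_neq0.
rewrite predC11 iwp1_predict_mean0 iwp1_predict_mean1 iwp1_predict_cov01.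
rewrite b0 b1 C01 C11; field.
by rewrite s_neq0 sigma_neq0.
Qed.

Lemma meshS (R : realType) (t0 h : R) n : mesh t0 h n.+1 - mesh t0 h n = h.
Proof. by rewrite /mesh -natr1; ring. Qed.

Lemma pfos_tracks_pec1 (R : realType) (f : R -> R -> R) (t0 y0 sigma h : R)
    (m0 : 'cV[R]_2) (C0 : 'M[R]_2) n :
    sigma != 0 -> h != 0 -> posdefmx C0 ->
  tracks (pfos_pre f sigma y0 (mesh t0 h) (m0, C0) n.+1)
    (pec1_trapezoidal f t0 y0 h n).
Proof.
move=> sigma_neq0 h_neq0 posC; elim: n => [|n IHn].
  rewrite [pfos_pre _ _ _ _ _ _]/= subrr [mesh t0 h 0]/mesh mul0r addr0.
  exact: pfos_step_init.
(* Unfolds a single step: simplification would also unfold the previous one. *)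
rewrite -[pfos_pre _ _ _ _ _ _]/(pfos_step f sigma (mesh t0 h n.+1)
  (mesh t0 h n.+1 - mesh t0 h n) (pfos_pre f sigma y0 (mesh t0 h) (m0, C0) n.+1)).
rewrite meshS /=; case: pec1_trapezoidal IHn => y fy IHn.
exact: pfos_step_pec1.
Qed.

Theorem proposition1 (R : realType) (t0 T : R) (f : R -> R -> R) (r : nat)
  (hlip : lipschitz_in_2nd t0 T f)
  (hr : (0 < r)%N)
  (hdiff : differentiable_times r (strip t0 T) (fun p : R * R => f p.1 p.2))
  (y0 sigma : R) (hsigma : 0 < sigma ^+ 2)
  (N : nat) (h : R) (hh : 0 < h) (hT : t0 + N%:R * h <= T)
  (m0 : 'cV[R]_2) (C0 : 'M[R]_2) (hC0 : posdefmx C0) :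
  forall n : nat, (n <= N)%N ->
    pfos_mean f sigma y0 (mesh t0 h) (m0, C0) n 0 0 =
      (pec1_trapezoidal f t0 y0 h n).1.
Proof.
move=> n _.
have sigma_neq0 : sigma != 0 by rewrite -sqrf_eq0 lt0r_neq0.
by case: (pfos_tracks_pec1 f t0 y0 m0 n sigma_neq0 (lt0r_neq0 hh) hC0).
Qed.
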